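(* Let $\mathcal{S}$ be a complete idempotent semiring equipped with a dual product $\odot$, and let $A,B\in\mathcal{S}^{n\times n}$. Suppose that for all $X\in\mathcal{S}^{n\times m}$ the equality $$B_\ast\backslash_{\odot}(A^\ast\otimes X)=(B_\ast\backslash_{\odot}A^\ast)\otimes X$$ holds. Then the mapping $$P:\mathcal{S}^{n\times m}\to\mathcal{S}^{n\times m},\qquad X\mapsto (B_\ast\backslash_{\odot}A^\ast)^\ast\backslash X$$ is a projector in $\operatorname{Im}L_{A^\ast}\cap\operatorname{Im}\Lambda_{B_\ast}$ (that is, $P\circ P=P$ and $P$ takes values in this set), and formally, for every $X\in\mathcal{S}^{n\times m}$, $$P(X)=\bigvee\{\,Y\in\mathcal{S}^{n\times m} : Y\preceq X \text{ and } Y\in\operatorname{Im}L_{A^\ast}\cap\operatorname{Im}\Lambda_{B_\ast}\}.$$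
   Context: An idempotent semiring is a set $\mathcal{S}$ with operations $\oplus,\otimes$ such that $(\mathcal{S},\oplus,\varepsilon)$ is a commutative monoid with $a\oplus a=a$, $(\mathcal{S},\otimes,e)$ is a monoid, $\otimes$ distributes over $\oplus$, and $\varepsilon$ is absorbing for $\otimes$. It is ordered by $a\succeq b\iff a=a\oplus b$. It is complete if arbitrary sums $\bigoplus$ exist and $\otimes$ distributes over arbitrary sums; then it is a complete lattice with join $\bigoplus$ (also written $\bigvee$), meet $\bigwedge$, bottom $\varepsilon$ and top $\top$. A dual product on $\mathcal{S}$ is an operation $\odot$ such that $(\mathcal{S},\odot,e)$ is a monoid (same neutral element $e$), $\odot$ distributes (on both sides) over arbitrary meets $\bigwedge$, and $\top$ is absorbing: $\top\odot a=a\odot\top=\top$ for all $a$. Matrices are ordered entrywise. Matrix products: $(A\otimes X)_{ij}=\bigoplus_k a_{ik}\otimes x_{kj}$ and $(A\odot X)_{ij}=\bigwedge_k a_{ik}\odot x_{kj}$. Put $L_A(X)=A\otimes X$ and $\Lambda_A(X)=A\odot X$. $A\backslash X$ denotes the greatest matrix $Y$ with $A\otimes Y\preceq X$ (the residual of $L_A$), and $A\backslash_{\odot}X$ denotes the smallest matrix $Y$ with $A\odot Y\succeq X$ (the dual residual of $\Lambda_A$); both exist. $E$ is the matrix with $E_{ii}=e$, $E_{ij}=\varepsilon$ for $i\ne j$; $E^\odot$ is the matrix with $E^\odot_{ii}=e$, $E^\odot_{ij}=\top$ for $i\neq j$. For a square matrix $A$: $A^0=E$, $A^k=A\otimes A^{k-1}$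 and $A^\ast=\bigoplus_{k\ge0}A^k$. For a square matrix $B$: $B^{\odot0}=E^\odot$, $B^{\odot k}=B\odot B^{\odot(k-1)}$ and $B_\ast=\bigwedge_{k\ge0}B^{\odot k}$. Here $L_{A^\ast}$ and $\Lambda_{B_\ast}$ are regarded as maps $\mathcal{S}^{n\times m}\to\mathcal{S}^{n\times m}$, and $\operatorname{Im}$ denotes the image. *)

(* Defs.v *)
From HB Require Import structures.
From mathcomp Require Import all_boot all_order all_algebra.
From mathcomp Require Import boolp classical_sets.

Set Implicit Arguments.
Unset Strict Implicit.
Unset Printing Implicit Defensive.

Import Order.TTheory GRing.Theory.
Local Open Scope classical_set_scope.
Local Open Scope ring_scope.
Local Open Scope order_scope.

HB.mixin Record isCompleteLattice d L of Order.POrder d L := {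
  bigvee : set L -> L;
  bigvee_ub : forall A : set L, ubound A (bigvee A);
  bigvee_least : forall A : set L, lbound (ubound A) (bigvee A)
}.

#[short(type="completeLatticeType")]
HB.structure Definition CompleteLattice d :=
  { L of isCompleteLattice d L & Order.POrder d L }.

Section CompleteLatticeTheory.
Context {d : Order.disp_t} {L : completeLatticeType d}.

Definition bigwedge (A : set L) : L := bigvee (lbound A).

Definition ctop : L := bigvee [set: L].

Lemma bigwedge_lb (A : set L) : lbound A (bigwedge A).
Proof. by move=> x Ax; apply: bigvee_least => y; apply. Qed.

Lemma bigwedge_greatest (A : set L) : ubound (lbound A) (bigwedge A).
Proof. exact: bigvee_ub. Qed.

Lemma lectop (x : L) : x <= ctop.
Proof. exact: bigvee_ub. Qed.

End CompleteLatticeTheory.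

(* As a join and a meet; le_lresmx and dlresmx_le below show that for matrix
   products these are attained, i.e. that they are the greatest X with
   f X <= Y and the smallest X with Y <= f X. *)
Definition residual {d d'} {L : completeLatticeType d} {M : porderType d'}
  (f : L -> M) (Y : M) : L := bigvee [set X | f X <= Y].

Definition dresidual {d d'} {L : completeLatticeType d} {M : porderType d'}
  (f : L -> M) (Y : M) : L := bigwedge [set X | Y <= f X].

(* The order is a derived notion: b is below a iff a = a + b.  The last four
   axioms say that the sum of an arbitrary subset is its least upper bound and
   that products distribute over such sums; the distributivity laws at A = set0
   are the absorption laws of the zero. *)
HB.mixin Record isCompleteIdempotent S of GRing.PzSemiRing S := {
  bigoplus : set S -> S;
  oplusxx : forall a : S, a + a = a;
  bigoplus_ub : forall (A : set S) (a : S),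
    A a -> bigoplus A = bigoplus A + a;
  bigoplus_least : forall (A : set S) (b : S),
    (forall a, A a -> b = b + a) -> b = b + bigoplus A;
  mulr_bigoplusr : forall (a : S) (A : set S),
    a * bigoplus A = bigoplus [set a * x | x in A];
  mulr_bigoplusl : forall (a : S) (A : set S),
    bigoplus A * a = bigoplus [set x * a | x in A]
}.

#[short(type="completeIdempotentSemiRingType")]
HB.structure Definition CompleteIdempotentSemiRing :=
  { S of isCompleteIdempotent S & GRing.PzSemiRing S }.

Fact oplus_display : Order.disp_t. Proof. exact: Order.Disp tt tt. Qed.

Section SemiRingOrder.
Context {S : completeIdempotentSemiRingType}.
Implicit Types a b : S.

Definition leoplus b a := a == a + b.

Lemma leoplus_refl : reflexive leoplus.
Proof. by move=> a; rewrite /leoplus oplusxx. Qed.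

Lemma leoplus_anti : antisymmetric leoplus.
Proof. by move=> a b /andP[/eqP ba /eqP ->]; rewrite addrC. Qed.

Lemma leoplus_trans : transitive leoplus.
Proof.
by move=> b a c /eqP ab /eqP bc; apply/eqP; rewrite {1}bc ab addrA -bc.
Qed.

(* No structure can join semirings with orders of an arbitrary display, because
   of the existing Num.POrderedZmodule; hence these instances on the carrier. *)
#[non_forgetful_inheritance]
HB.instance Definition _ := Order.Le_isPOrder.Build oplus_display
  (CompleteIdempotentSemiRing.sort S) leoplus_refl leoplus_anti leoplus_trans.

Lemma le_oplus a b : (b <= a)%O <-> a = a + b.
Proof. by split=> [/eqP|?]; [|apply/eqP]. Qed.

Lemma bigoplus_ubound (A : set S) : ubound A (bigoplus A).
Proof. by move=> a Aa; apply/le_oplus/bigoplus_ub. Qed.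

Lemma bigoplus_lbound (A : set S) : lbound (ubound A) (bigoplus A).
Proof.
by move=> b Ab; apply/le_oplus/bigoplus_least => a /Ab /le_oplus.
Qed.

#[non_forgetful_inheritance]
HB.instance Definition _ := isCompleteLattice.Build oplus_display
  (CompleteIdempotentSemiRing.sort S) bigoplus_ubound bigoplus_lbound.

Lemma bigoplusE (A : set S) : bigoplus A = bigvee A.
Proof. by []. Qed.

Lemma mulr_bigvee a (A : set S) :
  a * bigvee A = bigvee [set a * x | x in A].
Proof. exact: mulr_bigoplusr. Qed.

Lemma mulr_bigveel a (A : set S) :
  bigvee A * a = bigvee [set x * a | x in A].
Proof. exact: mulr_bigoplusl. Qed.

End SemiRingOrder.

Record dualProduct (S : completeIdempotentSemiRingType) := DualProduct {
  dmul :> S -> S -> S;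
  dmulA : associative dmul;
  dmul1l : left_id (1 : S) dmul;
  dmul1r : right_id (1 : S) dmul;
  dmul_bigwedger : forall (a : S) (A : set S),
    dmul a (bigwedge A) = bigwedge [set dmul a x | x in A];
  dmul_bigwedgel : forall (a : S) (A : set S),
    dmul (bigwedge A) a = bigwedge [set dmul x a | x in A];
  dmul_topr : right_zero (ctop : S) dmul;
  dmul_topl : left_zero (ctop : S) dmul
}.

Section MatrixOrder.
Context {d : Order.disp_t} {S : porderType d} (m n : nat).
Implicit Types X Y : 'M[S]_(m, n).

Definition lemx X Y := [forall i, forall j, X i j <= Y i j].

Lemma lemxP X Y : reflect (forall i j, X i j <= Y i j) (lemx X Y).
Proof. by apply: (iffP 'forall_forallP). Qed.

Lemma lemx_refl : reflexive lemx.
Proof. by move=> X; apply/lemxP => i j. Qed.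

Lemma lemx_anti : antisymmetric lemx.
Proof.
move=> X Y /andP[/lemxP XY /lemxP YX]; apply/matrixP => i j.
by apply: le_anti; rewrite XY YX.
Qed.

Lemma lemx_trans : transitive lemx.
Proof.
move=> Y X Z /lemxP XY /lemxP YZ; apply/lemxP => i j.
exact: le_trans (XY i j) (YZ i j).
Qed.

HB.instance Definition _ := Order.Le_isPOrder.Build d 'M[S]_(m, n)
  lemx_refl lemx_anti lemx_trans.

End MatrixOrder.

Section MatrixLattice.
Context {d : Order.disp_t} {S : completeLatticeType d} (m n : nat).
Implicit Types A : set 'M[S]_(m, n).

Definition bigveemx A : 'M[S]_(m, n) :=
  \matrix_(i, j) bigvee [set (X : 'M[S]_(m, n)) i j | X in A].

Lemma bigveemx_ub A : ubound A (bigveemx A).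
Proof.
by move=> X AX; apply/lemxP => i j; rewrite mxE; apply: bigvee_ub; exists X.
Qed.

Lemma bigveemx_least A : lbound (ubound A) (bigveemx A).
Proof.
move=> Y AY; apply/lemxP => i j; rewrite mxE; apply: bigvee_least.
by move=> _ [X AX <-]; move/lemxP: (AY X AX); apply.
Qed.

HB.instance Definition _ := isCompleteLattice.Build d 'M[S]_(m, n)
  bigveemx_ub bigveemx_least.

Lemma bigwedgemxE A i j :
  bigwedge A i j = bigwedge [set (X : 'M[S]_(m, n)) i j | X in A].
Proof.
apply: le_anti; apply/andP; split.
  apply: bigwedge_greatest => _ [X AX <-].
  by have /lemxP := bigwedge_lb AX; apply.
pose Y : 'M[S]_(m, n) :=
  \matrix_(k, l) bigwedge [set (X : 'M[S]_(m, n)) k l | X in A].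
have /lemxP/(_ i j) : Y <= bigwedge A; last by rewrite mxE.
apply: bigwedge_greatest => X AX; apply/lemxP => k l; rewrite mxE.
by apply: bigwedge_lb; exists X.
Qed.

End MatrixLattice.

Definition kleene {S : completeIdempotentSemiRingType} {n}
  (A : 'M[S]_n) : 'M[S]_n := bigvee (range (fun k : nat => (A ^+ k)%R)).

Section DualProduct.
Context {S : completeIdempotentSemiRingType} (odot : dualProduct S).

Definition dmulmx {n p m} (A : 'M[S]_(n, p)) (X : 'M[S]_(p, m)) :
    'M[S]_(n, m) :=
  \matrix_(i, j) bigwedge (range (fun k : 'I_p => odot (A i k) (X k j))).

Definition dunitmx {n} : 'M[S]_n :=
  \matrix_(i, j) if i == j then 1 else (ctop : S).

Definition dexpmx {n} (B : 'M[S]_n) (k : nat) : 'M[S]_n :=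
  iter k (dmulmx B) dunitmx.

Definition dkleene {n} (B : 'M[S]_n) : 'M[S]_n := bigwedge (range (dexpmx B)).

End DualProduct.

(* A \ X and B \_odot X *)
Definition lresmx {S : completeIdempotentSemiRingType} {n p m}
  (A : 'M[S]_(n, p)) (X : 'M[S]_(n, m)) : 'M[S]_(p, m) :=
  residual (mulmx A) X.

Definition dlresmx {S : completeIdempotentSemiRingType} (odot : dualProduct S)
  {n p m} (B : 'M[S]_(n, p)) (X : 'M[S]_(n, m)) : 'M[S]_(p, m) :=
  dresidual (dmulmx odot B) X.

Section SemiRingTheory.
Context {S : completeIdempotentSemiRingType}.

Lemma oplus_le (a b c : S) : ((a + b)%R <= c) = (a <= c) && (b <= c).
Proof.
have ubl (x y : S) : x <= (x + y)%R.
  by apply/le_oplus; rewrite addrAC oplusxx.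
apply/idP/andP => [abc|[/le_oplus ac /le_oplus bc]].
  split; apply: le_trans abc => //.
  by rewrite addrC.
by apply/le_oplus; rewrite addrA -ac.
Qed.

Lemma le0S (a : S) : (0%R : S) <= a.
Proof. by apply/le_oplus; rewrite addr0. Qed.

Lemma sum_le (I : finType) (F : I -> S) (c : S) :
  reflect (forall i, F i <= c) ((\sum_i F i)%R <= c).
Proof.
apply: (iffP idP) => [Fc i|Fc]; last first.
  by elim/big_ind: _ => [|a b ac bc|//]; rewrite ?le0S// oplus_le ac.
by move: Fc; rewrite (bigD1 i)//= oplus_le => /andP[].
Qed.

Lemma le_lresmx n p m (A : 'M[S]_(n, p)) (X : 'M[S]_(n, m))
    (Y : 'M[S]_(p, m)) :
  (Y <= lresmx A X) = ((A *m Y)%R <= X).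
Proof.
apply/idP/idP => [/lemxP YAX|]; last exact: bigvee_ub.
apply/lemxP => i j; rewrite mxE; apply/sum_le => k.
apply: (@le_trans _ _ (A i k * (lresmx A X) k j)%R).
  have /le_oplus -> := YAX k j.
  by rewrite mulrDr; apply/le_oplus; rewrite -addrA oplusxx.
rewrite mxE mulr_bigvee; apply: bigvee_least => _ [_ [Z AZX <-] <-].
by move/lemxP: AZX => /(_ i j); rewrite mxE => /sum_le; apply.
Qed.

End SemiRingTheory.

Lemma dlresmx_le (S : completeIdempotentSemiRingType) (odot : dualProduct S) n p m
    (B : 'M[S]_(n, p)) (X : 'M[S]_(n, m)) (Y : 'M[S]_(p, m)) :
  (dlresmx odot B X <= Y) = (X <= dmulmx odot B Y).
Proof.
have odot_mono (a x y : S) : x <= y -> odot a x <= odot a y.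
  move=> xy; have -> : x = bigwedge [set x; y].
    apply: le_anti; apply/andP; split; last by apply: bigwedge_lb; left.
    by apply: bigwedge_greatest => _ [] ->.
  by rewrite dmul_bigwedger; apply: bigwedge_lb; exists y => //; right.
apply/idP/idP => [/lemxP BXY|]; last exact: bigwedge_lb.
apply/lemxP => i j; rewrite mxE; apply: bigwedge_greatest => _ [k _ <-].
apply: le_trans (odot_mono _ _ _ (BXY k j)).
rewrite bigwedgemxE dmul_bigwedger.
apply: bigwedge_greatest => _ [_ [Z XBZ <-] <-].
move/lemxP: XBZ => /(_ i j) /le_trans; apply; rewrite mxE.
by apply: bigwedge_lb; exists k.
Qed.

(* Main.v *)
(* By the residuation adjunctions and the hypothesis, D Y <= Y means
   A^* Y <= B_* (.) Y; since B_* (.) Y <= Y <= A^* Y always holds, this says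
   that Y is fixed by both maps.  So the intersection of the two images is
   {Y | D^* Y <= Y}, and D^* \ X is the greatest such Y below X. *)
Require Import Defs.
From mathcomp Require Import all_boot all_order all_algebra.
From mathcomp Require Import boolp classical_sets.
Local Open Scope classical_set_scope.
Local Open Scope ring_scope.
Local Open Scope order_scope.

Set Implicit Arguments.
Unset Strict Implicit.
Unset Printing Implicit Defensive.

Import Order.TTheory GRing.Theory.

Section Kleene.
Context {S : completeIdempotentSemiRingType}.

Lemma mulr_bigveel_leP (a c : S) (U : set S) :
  (bigvee U * a)%R <= c <-> forall x, U x -> (x * a)%R <= c.
Proof.
rewrite mulr_bigveel; split=> [Uc x Ux|Uc].
  by apply: le_trans Uc; apply: bigvee_ub; exists x.
by apply: bigvee_least => _ [x Ux <-]; apply: Uc.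
Qed.

(** Lets a bound on [kleene A *m Y] be tested power by power. It rests on distributivity over
    arbitrary joins, applied entrywise. *)
Lemma bigvee_mulmx_leP n p m (U : set 'M[S]_(n, p)) (Y : 'M[S]_(p, m))
    (Z : 'M[S]_(n, m)) :
  (bigvee U *m Y)%R <= Z <-> forall X, U X -> (X *m Y)%R <= Z.
Proof.
split=> [/lemxP UZ X UX|UZ]; apply/lemxP => i j; rewrite mxE; apply/sum_le => k.
  have := UZ i j; rewrite mxE => /sum_le /(_ k).
  by rewrite mxE => /mulr_bigveel_leP; apply; exists X.
rewrite mxE; apply/mulr_bigveel_leP => _ [X UX <-].
by have /lemxP/(_ i j) := UZ X UX; rewrite mxE => /sum_le.
Qed.

Lemma mulmx_le2l n p m (A : 'M[S]_(n, p)) (X Y : 'M[S]_(p, m)) :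
  X <= Y -> (A *m X)%R <= (A *m Y)%R.
(* By residuation the goal is [X <= lresmx A (A *m Y)], and [Y] already lies below that residual. *)
Proof. by move=> XY; rewrite -le_lresmx (le_trans XY) // le_lresmx. Qed.

(** [A] is the term of exponent 1 of the star; conversely, [A *m Y <= Y] propagates to every power
    by induction. *)
Lemma kleene_mulmx_leP n m (A : 'M[S]_n) (Y : 'M[S]_(n, m)) :
  (kleene A *m Y)%R <= Y <-> (A *m Y)%R <= Y.
Proof.
rewrite /kleene bigvee_mulmx_leP; split=> [|AY _ [k _ <-]].
  by apply; exists 1%N; rewrite ?expr1.
elim: k => [|k IHk]; first by rewrite expr0 mul1mx.
by rewrite exprS -mulmxA (le_trans _ AY) // mulmx_le2l.
Qed.

Lemma le_kleene_mulmx n m (A : 'M[S]_n) (Y : 'M[S]_(n, m)) :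
  Y <= (kleene A *m Y)%R.
Proof.
have /bigvee_mulmx_leP := le_refl (kleene A *m Y)%R.
by move=> /(_ 1%R); rewrite mul1mx; apply; exists 0%N; rewrite ?expr0.
Qed.

(** Residuation reduces the claim to single powers, and [A *m A ^+ k] is again a term of the
    join. *)
Lemma mul_kleene_le n (A : 'M[S]_n) : (A *m kleene A)%R <= kleene A.
Proof.
rewrite -le_lresmx; apply: bigvee_least => _ [k _ <-]; rewrite le_lresmx.
by apply: bigvee_ub; exists k.+1; rewrite ?exprS.
Qed.

Lemma kleene_mulK n (A : 'M[S]_n) : (kleene A *m kleene A)%R = kleene A.
Proof.
apply: le_anti; rewrite le_kleene_mulmx andbT.
exact/kleene_mulmx_leP/mul_kleene_le.
Qed.

(** Multiplication by [kleene A] is idempotent and lies above the identity, so its image is its set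
    of fixed points and one inequality suffices. *)
Lemma range_kleeneP n m (A : 'M[S]_n) (Y : 'M[S]_(n, m)) :
  range (mulmx (kleene A)) Y <-> (kleene A *m Y)%R <= Y.
Proof.
split=> [[X _ <-]|AY]; first by rewrite mulmxA kleene_mulK.
by exists Y => //; apply: le_anti; rewrite AY le_kleene_mulmx.
Qed.

End Kleene.

Section DualKleene.
Context {S : completeIdempotentSemiRingType} (odot : dualProduct S).

Lemma le_dmul_bigwedgelP (a c : S) (U : set S) :
  c <= odot (bigwedge U) a <-> forall x, U x -> c <= odot x a.
Proof.
rewrite dmul_bigwedgel; split=> [Uc x Ux|Uc].
  by apply: le_trans Uc _; apply: bigwedge_lb; exists x.
by apply: bigwedge_greatest => _ [x Ux <-]; apply: Uc.
Qed.

Lemma le_dmul_bigwedgerP (a c : S) (U : set S) :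
  c <= odot a (bigwedge U) <-> forall x, U x -> c <= odot a x.
Proof.
rewrite dmul_bigwedger; split=> [Uc x Ux|Uc].
  by apply: le_trans Uc _; apply: bigwedge_lb; exists x.
by apply: bigwedge_greatest => _ [x Ux <-]; apply: Uc.
Qed.

Lemma le_dmulmx_entryP n p m (A : 'M[S]_(n, p)) (X : 'M[S]_(p, m)) i j c :
  c <= dmulmx odot A X i j <-> forall k, c <= odot (A i k) (X k j).
Proof.
rewrite mxE; split=> [cAX k|cAX].
  by apply: le_trans cAX _; apply: bigwedge_lb; exists k.
by apply: bigwedge_greatest => _ [k _ <-].
Qed.

Lemma le_dmulmxP n p m (A : 'M[S]_(n, p)) (X : 'M[S]_(p, m)) Z :
  Z <= dmulmx odot A X <-> forall i j k, Z i j <= odot (A i k) (X k j).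
Proof.
split=> [/lemxP ZAX i j|ZAX]; first exact/le_dmulmx_entryP.
by apply/lemxP => i j; apply/le_dmulmx_entryP.
Qed.

Lemma le_bigwedge_dmulmxP n p m (U : set 'M[S]_(n, p)) (Y : 'M[S]_(p, m)) Z :
  Z <= dmulmx odot (bigwedge U) Y <-> forall X, U X -> Z <= dmulmx odot X Y.
Proof.
split=> [/le_dmulmxP ZU X UX|ZU]; apply/le_dmulmxP => i j k.
  have := ZU i j k; rewrite bigwedgemxE => /le_dmul_bigwedgelP; apply.
  by exists X.
rewrite bigwedgemxE; apply/le_dmul_bigwedgelP => _ [X UX <-].
by have /le_dmulmxP := ZU X UX; apply.
Qed.

Lemma dmulmx_le2l n p m (A : 'M[S]_(n, p)) (X Y : 'M[S]_(p, m)) :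
  X <= Y -> dmulmx odot A X <= dmulmx odot A Y.
Proof. by move=> XY; rewrite -dlresmx_le (le_trans _ XY) // dlresmx_le. Qed.

(** Distributivity expands both sides into meets of the same triple products. It covers empty meets,
    so inner dimensions may be zero. *)
Lemma dmulmxA n p q m (A : 'M[S]_(n, p)) (B : 'M[S]_(p, q))
    (X : 'M[S]_(q, m)) :
  dmulmx odot A (dmulmx odot B X) = dmulmx odot (dmulmx odot A B) X.
Proof.
apply: le_anti; apply/andP; split; apply/le_dmulmxP => i j k.
  rewrite [dmulmx odot A B i k]mxE.
  apply/le_dmul_bigwedgelP => _ [l _ <-]; rewrite -dmulA.
  (* Reflexivity bounds the entry by each term of the outer meet; distributing over the inner one
     isolates index [k]. *)
  have /le_dmulmxP/(_ i j l) := le_refl (dmulmx odot A (dmulmx odot B X)).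
  by rewrite [dmulmx odot B X l j]mxE => /le_dmul_bigwedgerP; apply; exists k.
rewrite [dmulmx odot B X k j]mxE.
apply/le_dmul_bigwedgerP => _ [l _ <-]; rewrite dmulA.
have /le_dmulmxP/(_ i j l) := le_refl (dmulmx odot (dmulmx odot A B) X).
by rewrite [dmulmx odot A B i l]mxE => /le_dmul_bigwedgelP; apply; exists k.
Qed.

Lemma dmul1mx n m (X : 'M[S]_(n, m)) : dmulmx odot dunitmx X = X.
Proof.
apply: le_anti; apply/andP; split.
  apply/lemxP => i j.
  have /le_dmulmxP/(_ i j i) := le_refl (dmulmx odot dunitmx X).
  by rewrite [dunitmx i i]mxE eqxx dmul1l.
apply/le_dmulmxP => i j k; rewrite mxE; case: eqP => [<-|_].
  by rewrite dmul1l.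
(* Off the diagonal the unit is top, which is absorbing, so these terms do not constrain the
   meet. *)
by rewrite dmul_topl lectop.
Qed.

Lemma dkleene_dmulmx_le n m (B : 'M[S]_n) (Y : 'M[S]_(n, m)) :
  dmulmx odot (dkleene odot B) Y <= Y.
Proof.
have /le_bigwedge_dmulmxP := le_refl (dmulmx odot (dkleene odot B) Y).
by move=> /(_ dunitmx); rewrite dmul1mx; apply; exists 0%N.
Qed.

Lemma dkleene_le_dmul n (B : 'M[S]_n) :
  dkleene odot B <= dmulmx odot B (dkleene odot B).
Proof.
rewrite -dlresmx_le; apply: bigwedge_greatest => _ [k _ <-].
by rewrite dlresmx_le; apply: bigwedge_lb; exists k.+1.
Qed.

Lemma le_dkleene_dmulmx n m (B : 'M[S]_n) (Y : 'M[S]_(n, m)) :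
  Y <= dmulmx odot B Y -> Y <= dmulmx odot (dkleene odot B) Y.
Proof.
move=> YB; apply/le_bigwedge_dmulmxP => _ [k _ <-].
elim: k => [|k IHk]; first by rewrite dmul1mx.
by rewrite /dexpmx iterS -dmulmxA (le_trans YB) // dmulmx_le2l.
Qed.

Lemma dkleene_dmulK n (B : 'M[S]_n) :
  dmulmx odot (dkleene odot B) (dkleene odot B) = dkleene odot B.
Proof.
apply: le_anti; rewrite dkleene_dmulmx_le /=.
exact/le_dkleene_dmulmx/dkleene_le_dmul.
Qed.

(** Dually, this map is idempotent and lies below the identity, so the reverse inequality
    characterises its fixed points. *)
Lemma range_dkleeneP n m (B : 'M[S]_n) (Y : 'M[S]_(n, m)) :
  range (dmulmx odot (dkleene odot B)) Y <->
  Y <= dmulmx odot (dkleene odot B) Y.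
Proof.
split=> [[X _ <-]|YB]; first by rewrite dmulmxA dkleene_dmulK.
by exists Y => //; apply: le_anti; rewrite YB dkleene_dmulmx_le.
Qed.

End DualKleene.

Lemma range_kleene_dkleeneP (S : completeIdempotentSemiRingType)
    (odot : dualProduct S) n m (A B : 'M[S]_n) (Y : 'M[S]_(n, m)) :
  (range (mulmx (kleene A)) `&` range (dmulmx odot (dkleene odot B)))%classic Y
  <-> (kleene A *m Y)%R <= dmulmx odot (dkleene odot B) Y.
Proof.
split=> [[/range_kleeneP AY /range_dkleeneP YB]|AB]; first exact: le_trans YB.
split.
  exact/range_kleeneP/(le_trans AB)/dkleene_dmulmx_le.
exact/range_dkleeneP/(le_trans _ AB)/le_kleene_mulmx.
Qed.

Theorem proposition36 (S : completeIdempotentSemiRingType)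
    (odot : dualProduct S) (n m : nat) (A B : 'M[S]_n)
    (D : 'M[S]_n := dlresmx odot (dkleene odot B) (kleene A))
    (P : 'M[S]_(n, m) -> 'M[S]_(n, m) := fun X => lresmx (kleene D) X)
    (Im : set 'M[S]_(n, m) :=
       (range (mulmx (kleene A)) `&` range (dmulmx odot (dkleene odot B)))%classic)
    (HAB : forall X : 'M[S]_(n, m),
       dlresmx odot (dkleene odot B) (kleene A *m X)%R = (D *m X)%R) :
  [/\ idempotent_fun P,
      (forall X : 'M[S]_(n, m), Im (P X)) &
      (forall X : 'M[S]_(n, m),
         P X = bigvee [set Y : 'M[S]_(n, m) | Y <= X /\ Im Y])].
Proof.
have ImP Y : Im Y <-> (kleene D *m Y)%R <= Y.
  by rewrite /Im range_kleene_dkleeneP -dlresmx_le HAB kleene_mulmx_leP.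
have P_le X : P X <= X.
  (* The chain is [P X <= kleene D *m P X <= X]; the second bound is the adjunction at [P X]
     itself. *)
  by apply: le_trans (le_kleene_mulmx D _) _; rewrite -le_lresmx.
have P_greatest X Y : Im Y -> Y <= X -> Y <= P X.
  by rewrite ImP le_lresmx; apply: le_trans.
have ImPX X : Im (P X).
  (* By adjunction [kleene D] need only be applied twice to [P X] and stay below [X]; idempotence of
     the star merges the two factors. *)
  by rewrite ImP le_lresmx mulmxA kleene_mulK -le_lresmx.
split=> [X|//|X]; apply: le_anti; apply/andP; split.
- exact: P_le.
(* [P X] is in [Im] and below itself, hence below [P (P X)]. *)
- exact: P_greatest.
- exact: bigvee_ub.
- by apply: bigvee_least => Y [YX ImY]; apply: P_greatest.
Qed.
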